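(* Let $\mathcal{E}$ be an $n$-dimensional solvable evolution algebra over a field $\mathbb{K}$, $n\geq 1$. Then $\mathcal{E}$ has maximum index of solvability if and only if $\operatorname{codim}\mathcal{E}^2=1$, i.e. $\dim\mathcal{E}^2=n-1$.
   Context: An evolution algebra over a field $\mathbb{K}$ is a finite-dimensional $\mathbb{K}$-algebra $\mathcal{E}$ (bilinear product, not necessarily associative) admitting a basis $B=\{e_1,\dots,e_n\}$, called a natural basis, with $e_ie_j=0$ for $i\neq j$. $\mathcal{E}^2=\mathcal{E}\mathcal{E}$ is the span of all products, i.e. the span of $e_1^2,\dots,e_n^2$. Put $\mathcal{E}^{(1)}=\mathcal{E}$, $\mathcal{E}^{(k+1)}=\mathcal{E}^{(k)}\mathcal{E}^{(k)}$ (span of products). $\mathcal{E}$ is solvable if $\mathcal{E}^{(k)}=0$ for some $k$, the least such $k$ being its index of solvability. An $n$-dimensional solvable evolution algebra has maximum index of solvability if its index of solvability is $n+1$ (the largest possible). *)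

(* Defs.v *)
From HB Require Import structures.
From mathcomp Require Import all_boot all_order all_algebra.

Set Implicit Arguments.
Unset Strict Implicit.
Unset Printing Implicit Defensive.

Import GRing.Theory.
Local Open Scope ring_scope.

(* A finite-dimensional, not necessarily associative, K-algebra is a          *)
(* finite-dimensional vector space E : vectType K together with a bilinear    *)
(* product mul : {bilinear E -> E -> E}.                                      *)

Section EvolutionAlgebra.

Variables (K : fieldType) (E : vectType K) (mul : {bilinear E -> E -> E}).

Definition natural_basis (B : (\dim {:E}).-tuple E) : Prop :=
  basis_of {:E} B /\
  (forall i j : 'I_(\dim {:E}), i != j -> mul (tnth B i) (tnth B j) = 0).

Definition evolution_algebra : Prop :=
  exists B : (\dim {:E}).-tuple E, natural_basis B.

(* The span of all products u * v with u in U and v in V. As mul is bilinear, *)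
(* products of basis vectors suffice (prodsvP below); this is the             *)
(* construction of falgebra.prodv, without associativity.                     *)
Definition prodsv (U V : {vspace E}) : {vspace E} :=
  <<allpairs mul (vbasis U) (vbasis V)>>%VS.

Lemma prodsvP (U V W : {vspace E}) :
  reflect (forall u v, u \in U -> v \in V -> mul u v \in W)
          (prodsv U V <= W)%VS.
Proof.
apply: (iffP idP) => [sUVW u v Uu Vv | sUVW].
  apply: (subvP sUVW); rewrite (coord_vbasis Uu) (coord_vbasis Vv).
  rewrite linear_sumlz memv_suml // => i _; rewrite linear_sumr memv_suml // => j _.
  rewrite linearZl_LR linearZr_LR /= !memvZ //.
  by apply/memv_span/allpairs_f; apply/mem_nth; rewrite size_tuple.
apply/span_subvP => _ /allpairsP[[u v] /= [Uu Vv ->]].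
by rewrite sUVW ?vbasis_mem.
Qed.

(* E^(k), indexed from E^(1) = E; the value at k = 0 is a dummy.              *)
Definition derived (k : nat) : {vspace E} :=
  iter k.-1 (fun U => prodsv U U) {:E}%VS.

Definition solvable_algebra : Prop :=
  exists2 k : nat, (0 < k)%N & derived k = 0%VS.

Definition solvability_index (k : nat) : Prop :=
  [/\ (0 < k)%N, derived k = 0%VS &
      forall j : nat, (0 < j)%N -> derived j = 0%VS -> (k <= j)%N].

Definition maximum_solvability_index : Prop :=
  solvability_index (\dim {:E}).+1.

Definition codimv (U : {vspace E}) : nat := (\dim {:E} - \dim U)%N.

End EvolutionAlgebra.

(* Main.v *)
Require Import Defs.
From mathcomp Require Import all_boot all_order all_algebra.

Import GRing.Theory.
Local Open Scope ring_scope.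

(** In a natural basis [e_1, ..., e_n] the product is [x y = T (x o y)], where
    [o] is the coordinatewise product and [T] the linear map [e_i |-> e_i^2],
    whose image is [E^2].  Row reduction gives a basis of a subspace [U] that
    restricts to the identity matrix on some [dim U] coordinates; its
    coordinatewise squares do so too, hence are free.  Therefore
    [dim (U U) >= dim U - dim (ker T) = dim U - codim E^2].  If [codim E^2 = 1]
    the derived series thus loses at most one dimension per step, while
    solvability makes it lose at least one. *)

Lemma coord_unit_family (K : fieldType) (E : vectType K) n (B : n.-tuple E)
    (U : {vspace E}) :
  basis_of fullv B ->
  exists (u : 'I_(\dim U) -> E) (f : 'I_(\dim U) -> 'I_n),
    (forall i, u i \in U) /\
    (forall i j, coord B (f j) (u i) = (i == j)%:R).
Proof.
move=> basB.
pose A := \matrix_(i < \dim U, j < n) coord B j (vbasis U)`_i.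
have freeA : row_free A.
  apply/inj_row_free => v vA0.
  suff sum0 : \sum_(i < \dim U) v 0 i *: (vbasis U)`_i = 0.
    have /freeP/(_ (v 0) sum0) v0 := basis_free (vbasisP U).
    by apply/rowP=> i; rewrite mxE v0.
  rewrite [LHS](coord_basis basB) ?memvf // big1 // => j _.
  rewrite linear_sum /=.
  move/rowP/(_ j): vA0; rewrite !mxE => vA0j.
  rewrite (eq_bigr (fun i => v 0 i * A i j)) ?vA0j ?scale0r // => i _.
  by rewrite linearZ /= mxE.
(* [fullrankfun] selects independent rows, hence the transpose: [f] picks [\dim U] columns of [A]
   that form an invertible matrix [S]. *)
have fullA : row_full A^T by rewrite /row_full mxrank_tr.
pose f := fullrankfun fullA.
pose S := colsub f A.
have unitS : S \in unitmx.
  rewrite -unitmx_tr -row_full_unit.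
  rewrite (_ : S^T = rowsub f A^T); first exact: fullrowsub_full.
  by apply/matrixP=> i j; rewrite !mxE.
(* Changing basis by the inverse of [S] turns the selected columns into the identity matrix. *)
exists (fun i => \sum_l invmx S i l *: (vbasis U)`_l), f; split=> [i | i j].
  by apply: memv_suml => l _; rewrite memvZ // vbasis_mem // mem_nth ?size_tuple.
rewrite linear_sum /=; have /matrixP/(_ i j) := mulVmx unitS.
rewrite !mxE => <-; apply: eq_bigr => l _.
by rewrite linearZ /= !mxE.
Qed.

Lemma dim_prodsv_self (K : fieldType) (E : vectType K)
    (mul : {bilinear E -> E -> E}) (U : {vspace E}) :
  evolution_algebra mul ->
  (\dim U + \dim (prodsv mul fullv fullv)
     <= \dim (prodsv mul U U) + \dim {:E})%N.
Proof.
case=> B [basB orthB].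
have [T defT] := linear_of_free B [seq mul e e | e <- B].
have {}defT (k : 'I_(\dim {:E})) : T B`_k = mul B`_k B`_k.
  have /(congr1 (fun s => s`_k)) : [seq T e | e <- B] = [seq mul e e | e <- B].
    by apply: defT; rewrite ?size_map ?(basis_free basB).
  by rewrite !(nth_map 0) ?size_tuple.
pose w x y := \sum_k (coord B k x * coord B k y) *: B`_k.
have mulE x y : mul x y = T (w x y).
  rewrite {1}(coord_basis basB (memvf x)) {1}(coord_basis basB (memvf y)).
  rewrite linear_sumlz linear_sum; apply: eq_bigr => i _.
  rewrite linear_sumr (bigD1 i) //= big1 ?addr0.
    by rewrite linearZl_LR linearZr_LR /= scalerA linearZ /= defT.
  move=> j ne_ji; rewrite linearZl_LR linearZr_LR /= -!tnth_nth.
  by rewrite orthB 1?eq_sym // !scaler0.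
pose L := linfun T.
have sqE : (prodsv mul fullv fullv <= limg L)%VS.
  by apply/prodsvP=> x y _ _; rewrite mulE -lfunE memv_img ?memvf.
have [u [f [Uu coord_u]]] := coord_unit_family _ _ _ B U basB.
pose W := [tuple w (u i) (u i) | i < \dim U].
have WE (i : 'I_(\dim U)) : W`_i = w (u i) (u i) by rewrite -tnth_nth tnth_mktuple.
have coordW (i j : 'I_(\dim U)) : coord B (f j) W`_i = (i == j)%:R.
  rewrite WE coord_sum_free ?(basis_free basB) // coord_u.
  (* The entries 0 and 1 are their own squares. *)
  by case: eqP => _; rewrite ?mulr1 ?mulr0.
have freeW : free W.
  apply/freeP=> c cW0 j; have := congr1 (coord B (f j)) cW0.
  rewrite linear0 linear_sum (bigD1 j) //= big1 ?addr0.
    by rewrite linearZ /= coordW eqxx mulr1.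
  by move=> i /negPf ne_ij; rewrite linearZ /= coordW ne_ij mulr0.
have sWU : (L @: <<W>> <= prodsv mul U U)%VS.
  rewrite limg_span; apply/span_subvP=> _ /mapP[_ /mapP[i _ ->] ->].
  by rewrite lfunE -mulE; apply: (prodsvP mul U U _ (subvv _)).
(* Rank-nullity for [L] on the span of [W], whose image lies in [prodsv mul U U]. *)
have leU : (\dim U <= \dim (lker L) + \dim (prodsv mul U U))%N.
  have <- : \dim <<W>> = \dim U by rewrite (eqnP freeW) size_tuple.
  by rewrite -(limg_ker_dim L) leq_add ?dimvS ?capvSr.
(* Rank-nullity on all of [E] bounds the kernel of [L] by the codimension of the square of [E]. *)
rewrite -(limg_ker_dim L fullv) capfv addnA [X in (_ <= X + _)%N]addnC.
by rewrite leq_add ?dimvS.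
Qed.

Section DerivedSeries.

Variables (K : fieldType) (E : vectType K) (mul : {bilinear E -> E -> E}).

Lemma prodsvS (U1 U2 V1 V2 : {vspace E}) :
  (U1 <= U2)%VS -> (V1 <= V2)%VS -> (prodsv mul U1 V1 <= prodsv mul U2 V2)%VS.
Proof.
move=> /subvP sU /subvP sV; apply/prodsvP=> u v /sU Uu /sV Vv.
exact: (prodsvP mul U2 V2 _ (subvv _)).
Qed.

Lemma derivedS k :
  derived mul k.+2 = prodsv mul (derived mul k.+1) (derived mul k.+1).
Proof. by []. Qed.

Lemma derived_subv k : (derived mul k.+2 <= derived mul k.+1)%VS.
Proof.
by elim: k => [|k IHk]; [apply: subvf | rewrite (derivedS k) prodsvS].
Qed.

Lemma derived_addn_subv j k : (derived mul (j + k).+1 <= derived mul j.+1)%VS.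
Proof.
elim: k => [|k IHk]; first by rewrite addn0.
by rewrite addnS (subv_trans (derived_subv _)).
Qed.

Lemma derived_stationary k :
  derived mul k.+2 = derived mul k.+1 ->
  forall m, derived mul (k + m).+1 = derived mul k.+1.
Proof.
move=> stat_k; elim=> [|m IHm]; first by rewrite addn0.
by rewrite addnS derivedS IHm -derivedS.
Qed.

(** A step without loss of dimension would make the series stationary at a nonzero space, so it
    would never reach 0. *)
Lemma dim_derived_lt k :
  solvable_algebra mul -> derived mul k.+1 != 0%VS ->
  (\dim (derived mul k.+2) < \dim (derived mul k.+1))%N.
Proof.
case=> -[//|m] _ dm0 nz; rewrite ltnNge; apply: contraNN nz => le_dim.
have /eqP/derived_stationary/(_ m) <- : derived mul k.+2 == derived mul k.+1.
  by rewrite eqEdim derived_subv.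
by rewrite -subv0 -[X in (_ <= X)%VS]dm0 addnC; apply: derived_addn_subv.
Qed.

Lemma dim_derived_upper j k :
  solvable_algebra mul ->
  (\dim (derived mul (j + k).+1) <= \dim (derived mul j.+1) - k)%N.
Proof.
move=> solE; elim: k => [|k IHk]; first by rewrite addn0 subn0.
rewrite addnS subnS.
(* Subtraction is truncated: once a term vanishes, so does the next one, and the bound holds
   trivially. *)
have [d0 | nz] := eqVneq (derived mul (j + k).+1) 0%VS.
  by rewrite (leq_trans (dimvS (derived_subv _))) // d0 dimv0.
have lt_d := leq_trans (dim_derived_lt _ solE nz) IHk.
by rewrite -ltnS prednK // (leq_trans _ lt_d).
Qed.

Lemma dim_derived_lower k :
  evolution_algebra mul -> codimv (prodsv mul fullv fullv) = 1%N ->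
  (\dim {:E} <= \dim (derived mul k.+1) + k)%N.
Proof.
move=> evoE codim1; elim: k => [|k IHk]; first by rewrite addn0.
apply: leq_trans IHk _; rewrite addnS -addSn leq_add2r derivedS.
have := dim_prodsv_self _ _ _ (derived mul k.+1) evoE.
have <- : (\dim (prodsv mul fullv fullv) + 1 = \dim {:E})%N.
  by rewrite -codim1 addnC subnK ?dimvS ?subvf.
by rewrite addnCA addnC leq_add2l addn1.
Qed.

End DerivedSeries.

Theorem proposition3p1 (K : fieldType) (E : vectType K)
    (mul : {bilinear E -> E -> E}) (n : nat) :
  (1 <= n)%N ->
  \dim {:E} = n ->
  evolution_algebra mul ->
  solvable_algebra mul ->
  maximum_solvability_index mul <-> codimv (prodsv mul fullv fullv) = 1%N.
Proof.
move=> n_gt0 dimE evoE solE; rewrite /maximum_solvability_index; split.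
  case=> _ _ min_n; set d := \dim (prodsv mul fullv fullv).
  have le_d : (d <= n - 1)%N by have := dim_derived_upper _ _ _ 0 1 solE; rewrite -dimE.
  (* From dimension [d] at the second term, strict descent reaches 0 in at most [d] steps. Hence the
     index is at most [d + 2], and index [n + 1] forces [n - 1 <= d]. *)
  have d0 : derived mul (1 + d).+1 = 0%VS.
    apply/eqP; rewrite -dimv_eq0 -leqn0 -[X in (_ <= X)%N](subnn d).
    exact: (dim_derived_upper _ _ _ 1 d solE).
  have := min_n _ (ltn0Sn _) d0; rewrite dimE ltnS add1n => le_n.
  rewrite /codimv dimE -/d; have -> : n = d.+1.
    by apply/eqP; rewrite eqn_leq le_n -(prednK n_gt0) ltnS -subn1.
  by rewrite subSnn.
move=> codim1; split=> // [|[//|j] _ dj0].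
  apply/eqP; rewrite -dimv_eq0 -leqn0 -[X in (_ <= X)%N](subnn (\dim {:E})).
  exact: (dim_derived_upper _ _ _ 0 (\dim {:E}) solE).
(* Losing at most one dimension per step, the series cannot vanish before [\dim {:E}] steps. *)
have := dim_derived_lower _ _ _ j evoE codim1.
by rewrite dj0 dimv0.
Qed.
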